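(* Let $X$ be a Hausdorff space and let $I\subset\mathbb{R}$ be an interval closed and bounded on the left with left end point $t_0$. Let $\mathcal{U}$ be a subset of $\mathcal{X}=\mathcal{C}_{\mathrm{loc}}(I,X)$. Suppose that (H1) $\Pi_{t_0}\mathcal{U}=X$. Suppose, moreover, that there exists a family $\mathfrak{K}'(X)$ of compact subsets of $X$ such that (H2) every tight Borel probability measure $\mu_0$ on $X$ is inner regular with respect to the family $\mathfrak{K}'(X)$; (H3) for every $K\in\mathfrak{K}'(X)$, the set $\Pi_{t_0}^{-1}K\cap\mathcal{U}$ is compact in $\mathcal{X}$. Then, for any tight Borel probability measure $\mu_0$ on $X$, there exists a $\mathcal{U}$-trajectory statistical solution $\rho$ over $I$ such that $\Pi_{t_0}\rho=\mu_0$.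
   Context: For a topological space $X$, $\mathfrak{B}_X$ denotes its Borel $\sigma$-algebra. A Borel measure $\mu$ on $X$ is inner regular with respect to a family $\mathfrak{F}\subset\mathfrak{B}_X$ if $\mu(A)=\sup\{\mu(F): F\in\mathfrak{F},\ F\subset A\}$ for every $A\in\mathfrak{B}_X$; it is tight if it is nonnegative and inner regular with respect to the family of all compact subsets of $X$. For a Hausdorff space $X$ and an interval $I\subset\mathbb{R}$, $\mathcal{X}=\mathcal{C}_{\mathrm{loc}}(I,X)$ is the set of all continuous functions $u:I\to X$ endowed with the compact-open topology, i.e. the topology generated by the subbase of sets $\{u: u(J)\subset O\}$ with $J\subset I$ a compact subinterval and $O\subset X$ open. For $t\in I$, $\Pi_t:\mathcal{X}\to X$ is the (continuous) map $\Pi_tu=u(t)$, and for a Borel measure $\rho$ on $\mathcal{X}$, $\Pi_t\rho$ is the push-forward $\Pi_t\rho(A)=\rho(\Pi_t^{-1}(A))$, $A\in\mathfrak{B}_X$. Given a subset $\mathcal{U}\subset\mathcal{X}$, a $\mathcal{U}$-trajectory statistical solution over $I$ is a Borel probability measure $\rho$ on $\mathcal{X}$ such that (i) $\rho$ is tight, and (ii) there exists $\mathcal{V}\in\mathfrak{B}_{\mathcal{X}}$ with $\mathcal{V}\subset\mathcal{U}$ and $\rho(\mathcal{X}\setminus\mathcal{V})=0$. *)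

(* Defs.v *)
From HB Require Import structures.
From mathcomp Require Import all_boot all_order all_algebra.
From mathcomp Require Import all_classical all_reals all_analysis.
From mathcomp Require Import lra.

Set Implicit Arguments.
Unset Strict Implicit.
Unset Printing Implicit Defensive.

Import Order.TTheory GRing.Theory Num.Theory.
Import numFieldNormedType.Exports.

Local Open Scope classical_set_scope.
Local Open Scope ring_scope.

Definition Cloc (R : realType) (I : interval R) (X : topologicalType) : Type :=
  continuousType (set_type [set` I]) X.

(* The pair (`[a, b], O) of a compact subinterval of I and an open set O is coded
   by (a, b, O). An empty `[a, b] (b < a) contributes the whole space, which is harmless. *)
Definition Cloc_index (R : realType) (I : interval R) (X : topologicalType) :
    set (R * R * set X) :=
  [set p | [set` `[p.1.1, p.1.2]] `<=` [set` I] /\ open p.2].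

Definition Cloc_subbase (R : realType) (I : interval R) (X : topologicalType)
    (p : R * R * set X) : set (Cloc I X) :=
  [set u | u @` [set t | \val t \in `[p.1.1, p.1.2]] `<=` p.2].

Section cloc_topology.
Variables (R : realType) (I : interval R).

HB.instance Definition _ (X : topologicalType) :=
  Choice.copy (Cloc I X) (continuousType (set_type [set` I]) X).

HB.instance Definition _ (X : topologicalType) :=
  @isSubBaseTopological.Build (Cloc I X) (R * R * set X)%type
    (@Cloc_index R I X) (@Cloc_subbase R I X).

HB.instance Definition _ (X : ptopologicalType) :=
  isPointed.Build (Cloc I X) (cst point : continuousType (set_type [set` I]) X).

End cloc_topology.

Section Cloc_compact_open.
Variables (R : realType) (I : interval R) (X : topologicalType).
Local Notation T := (set_type [set` I]).

Let segment (a b : R) : set T := [set t | \val t \in `[a, b]].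

Let compact_segment (a b : R) :
  [set` `[a, b]] `<=` [set` I] -> compact (segment a b).
Proof.
move=> abI F PF Fab; have Fab' : (\val @ F) [set` `[a, b]] by [].
have [p [abp clp]] := @segment_compact R a b (\val @ F) _ Fab'.
exists (exist _ p (mem_set (abI _ abp))); split => // A B FA [_ [[C oC <-]] Cp sB].
have FA' : (\val @ F) [set \val t | t in A].
  by apply: (@filterS T F _ A) => // t At; exists t.
have [_ [[t At <-] Ct]] := clp _ _ FA' (open_nbhs_nbhs (conj oC Cp)).
by exists t; split => //; exact: sB.
Qed.

Let segment_basis (x : T) (B : set T) : nbhs x B ->
  exists a b : R, [/\ [set` `[a, b]] `<=` [set` I], segment a b `<=` B &
                   nbhs x (segment a b)].
Proof.
have xI : [set` I] (\val x) by exact/set_mem/valP.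
case=> _ [[C oC <-]] Cx sB.
have [e /= e0 eC] : nbhs_ball (\val x) C.
  by rewrite nbhs_ballE; exact: open_nbhs_nbhs.
have [a [aI ax ea aN]] : exists a : R, [/\ [set` I] a, a <= \val x,
    \val x - e < a & \forall y \near \val x, [set` I] y -> a <= y].
  have [[y [yI yx]]|noy] := pselect (exists y, [set` I] y /\ y < \val x).
    exists (Num.max y (\val x - e / 2)); split.
    - by case: leP => // ?; apply: (@interval_is_interval _ I y (\val x)) => //; lra.
    - by rewrite ge_max; lra.
    - by rewrite lt_max; apply/orP; right; lra.
    - near=> z => _; rewrite ge_max; apply/andP; split; near: z.
        exact: lt_le_nbhsr.
      by apply: lt_le_nbhsr; lra.
  exists (\val x); split => //; first by lra.
  near=> y; move=> yI; rewrite leNgt; apply/negP => yx.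
  by apply: noy; exists y.
have [b [bI xb be bN]] : exists b : R, [/\ [set` I] b, \val x <= b,
    b < \val x + e & \forall y \near \val x, [set` I] y -> y <= b].
  have [[y [yI yx]]|noy] := pselect (exists y, [set` I] y /\ \val x < y).
    exists (Num.min y (\val x + e / 2)); split.
    - by case: leP => // ?; apply: (@interval_is_interval _ I (\val x) y) => //; lra.
    - by rewrite le_min; lra.
    - by rewrite gt_min; apply/orP; right; lra.
    - near=> z => _; rewrite le_min; apply/andP; split; near: z.
        exact: lt_le_nbhsl.
      by apply: lt_le_nbhsl; lra.
  exists (\val x); split => //; first by lra.
  near=> y; move=> yI; rewrite leNgt; apply/negP => yx.
  by apply: noy; exists y.
exists a, b; split.
- move=> y; rewrite /= in_itv/= => /andP[ay yb].
  by apply: (@interval_is_interval _ I a b) => //; exact/andP.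
- move=> t; rewrite /segment/= in_itv/= => /andP[at_ tb]; apply: sB.
  by apply: eC; rewrite /ball/= ltr_norml; apply/andP; split; move: at_ tb ea be; rewrite !/(\val t) set_valE /=; lra.
- have : nbhs (\val x) [set y : R | ([set` I] y -> a <= y) /\ ([set` I] y -> y <= b)].
    exact: filterI aN bN.
  rewrite nbhsE => -[W [oW Wx] sW].
  exists (set_val @^-1` W); hnf; split; [by exists W|exact: Wx|].
  move=> t /sW[at_ tb].
  have tI : [set` I] (\val t) by exact/set_mem/valP.
  by rewrite /segment/= in_itv/=; apply/andP; split; [exact: at_|exact: tb].
Unshelve. all: by end_near. Qed.

(* The topology of Cloc is the compact-open topology of the library, restricted
   to continuous functions. *)
Lemma Cloc_compact_open (A : set (Cloc I X)) :
  open A <->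
  @open (initial_topology
    (id : continuousType T X -> {compact-open, T -> X})) A.
Proof.
split.
  case=> D' D'sub <-; apply: bigcup_open => B D'B.
  have [/= E sE <-] := D'sub _ D'B.
  rewrite bigcap_fset big_seq; apply: big_ind => [|? ?|p pE].
  - exact: openT.
  - exact: openI.
  have /set_mem[pI pO] := sE _ pE.
  exists [set g | g @` segment p.1.1 p.1.2 `<=` p.2] => //.
  by apply: compact_open_open => //; exact: compact_segment.
case=> C oC <-; rewrite openE => u Cu /=.
have cu : {for (u : Cloc I X), continuous
    ((fun v => v : T -> X) : Cloc I X -> {compact-open, T -> X})}.
  apply/(@compact_open_cvgP _ _ _ _ (fmap_filter _ (nbhs_filter (u : Cloc I X)))) => K O cK oO uKO.
  suff : nbhs (u : Cloc I X) [set v : Cloc I X | K `<=` [set t | O (v t)]].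
    by apply: filterS => v vKO _ [t Kt <-]; exact: vKO.
  apply: ((compact_near_coveringP K).1 cK _ (nbhs (u : Cloc I X)) (fun (v : Cloc I X) t => O (v t)) _) => t Kt.
  have Out : O (u t) by apply: uKO; exists t.
  have [a [b [abI abO abt]]] : exists a b : R, [/\ [set` `[a, b]] `<=` [set` I],
      segment a b `<=` u @^-1` O & nbhs t (segment a b)].
    by apply: segment_basis; apply: (@cts_fun _ _ u t); exact: open_nbhs_nbhs.
  exists (segment a b, [set v : Cloc I X | v @` segment a b `<=` O]).
    split => //=; apply: open_nbhs_nbhs; split; last first.
      by move=> _ [s abs <-]; exact: abO.
    pose S := [set v : Cloc I X | v @` segment a b `<=` O].
    exists [set S]; last by rewrite bigcup_set1.
    move=> _ ->; exists (finmap.fset1 (a, b, O)).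
      by move=> p /[!inE] /eqP ->.
    by rewrite set_fset1 bigcap_set1.
  by move=> [s v] /= [abs vab]; apply: vab; exists s.
by apply: cu; exact: open_nbhs_nbhs.
Qed.

End Cloc_compact_open.

Definition Pi (R : realType) (I : interval R) (X : topologicalType)
  (t : set_type [set` I]) (u : Cloc I X) : X := u t.

Definition borel (T : ptopologicalType) := g_sigma_algebraType (@open T).

Section borel_measures.
Variables (R : realType) (T : ptopologicalType).

(* The supremum is taken in \bar R (sup of the empty family = -oo). When T is
   Hausdorff its compact subsets are Borel, so mu K is then meaningful for every
   compact K. *)
Definition inner_regular (mu : set (borel T) -> \bar R) (F : set (set T)) :=
  forall A : set (borel T), measurable A ->
    mu A = ereal_sup [set mu K | K in [set K | F K /\ K `<=` A]].

Definition tight (mu : set (borel T) -> \bar R) :=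
  (forall A : set (borel T), measurable A -> (0 <= mu A)%E) /\
  inner_regular mu (@compact T).

End borel_measures.

Definition trajectory_statistical_solution (R : realType) (I : interval R)
    (X : ptopologicalType) (U : set (Cloc I X))
    (rho : probability (borel (Cloc I X)) R) :=
  tight rho /\
  exists V : set (borel (Cloc I X)),
    [/\ measurable V, V `<=` U & rho (~` V) = 0%E].

(* Main.v *)
(* A section s of Pi t0 with values in U need not be measurable, but a finitely
   additive extension of mu0 to all subsets of X can always be pushed forward by s.
   The push-forward l gives full mass to U, satisfies l (Pi t0 @^-1` A) = mu0 A,
   and by (H2) and (H3) it is approximated by the compact sets
   Pi t0 @^-1` K `&` U, with K in K'. As in the Riesz representation theorem, the
   outer measure generated by G |-> sup {l L | L compact, L `<=` G} on open sets
   restricts to a tight Borel probability rho with l L <= rho L for L compact, so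
   that rho is carried by U, and rho G <= l G for G open, so that the image of rho
   by Pi t0 is below mu0 on open sets, hence, by outer regularity of mu0, on all
   Borel sets, hence equal to mu0 since both have mass 1. *)
Require Import Defs.
From HB Require Import structures.
From mathcomp Require Import all_boot all_order all_algebra.
From mathcomp Require Import all_classical all_reals all_analysis.
From mathcomp Require Import lra.

Import Order.TTheory GRing.Theory Num.Theory.
Import numFieldNormedType.Exports.
Local Open Scope classical_set_scope.
Local Open Scope ring_scope.

(** * Finitely additive extensions of finite measures *)

(* A minimal monotone submodular l <= m with the mass of m is modular: otherwise
   A |-> l (A `|` E) + l (A `&` E) - l E would be strictly smaller for some E. *)
Lemma exists_modular_minorant (R : realType) (T : Type) (m : set T -> R) :
  m set0 = 0 -> {homo m : A B / A `<=` B >-> A <= B} ->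
  (forall A B, m (A `|` B) + m (A `&` B) <= m A + m B) ->
  exists l : set T -> R,
    [/\ l set0 = 0, l setT = m setT, {homo l : A B / A `<=` B >-> A <= B},
        forall A, l A <= m A &
        forall A B, l (A `|` B) + l (A `&` B) = l A + l B].
Proof.
move=> m0 m_homo m_sub.
pose P (l : set T -> R) := [/\ l set0 = 0, l setT = m setT,
  {homo l : A B / A `<=` B >-> A <= B}, forall A, l A <= m A &
  forall A B, l (A `|` B) + l (A `&` B) <= l A + l B].
have Pm : P m by split.
(* The order is reversed, so that the maximal element given by Zorn's lemma is a pointwise minimal
   set function. *)
pose le (s t : {l | P l}) := `[< forall A, sval t A <= sval s A >].
have [|r s t /asboolP rs /asboolP st|C C_total|[l [l0 lT l_homo lm l_sub]] l_min] :=
    @ZL_preorder _ (exist P m Pm) le.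
- by move=> t; exact/asboolP.
- by apply/asboolP => A; exact: le_trans (st A) (rs A).
- have [[c Cc]|/forallNP C0] := pselect (exists c, C c); last first.
    by exists (exist P m Pm) => s Cs; case: (C0 s).
  pose E A := [set sval s A | s in C].
  have E_lb A : has_inf (E A).
    split; first by exists (sval c A), c.
    exists 0 => _ [[s [s0 _ s_homo _ _]] _ <-] /=.
    by rewrite -s0 s_homo.
  have infE s A : C s -> inf (E A) <= sval s A.
    by move=> Cs; apply: ge_inf; [have [] := E_lb A|exists s].
  have inf_lt e A : 0 < e -> exists2 s, C s & sval s A < inf (E A) + e.
    by move=> e0; have [_ [s Cs <-] ?] := inf_adherent e0 (E_lb A); exists s.
  have infE_cst A r : (forall s : {l | P l}, sval s A = r) -> inf (E A) = r.
    move=> sA; rewrite (_ : E A = [set r]) ?inf1//.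
    by apply/seteqP; split => [_ [s _ <-]//|_ ->]; exists c.
  have Pinf : P (fun A => inf (E A)).
    split.
    + by apply: infE_cst => -[? []].
    + by apply: infE_cst => -[? []].
    + move=> A B AB; apply: lb_le_inf; first by have [] := E_lb B.
      move=> _ [s Cs <-]; apply: le_trans (infE s A Cs) _.
      by case: s Cs => s [? ? + ? ?] _; exact.
    + move=> A; apply: le_trans (infE c A Cc) _.
      by case: (c) => s [].
    + move=> A B; apply/ler_addgt0Pr => e e0.
      have e2 : 0 < e / 2 by lra.
      have [s Cs sA] := inf_lt _ A e2.
      have [t Ct tB] := inf_lt _ B e2.
      (* A chain has one member close to the infimum at both [A] and [B]; its submodularity passes
         to the infimum up to [e]. *)
      have [u Cu [uA uB]] : exists2 u, C u &
          sval u A < inf (E A) + e / 2 /\ sval u B < inf (E B) + e / 2.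
        have [/asboolP st|/asboolP ts] := C_total _ _ Cs Ct.
          by exists t => //; split => //; exact: le_lt_trans (st A) _.
        by exists s => //; split => //; exact: le_lt_trans (ts B) _.
      have := infE u (A `|` B) Cu; have := infE u (A `&` B) Cu.
      have : sval u (A `|` B) + sval u (A `&` B) <= sval u A + sval u B.
        by case: (u) => ? [].
      lra.
  by exists (exist P _ Pinf) => s Cs; apply/asboolP => A; exact: infE.
- exists l; split => // A E; apply/eqP; rewrite eq_le l_sub /=.
  pose l' B := l (B `|` E) + l (B `&` E) - l E.
  have Pl' : P l'.
    rewrite /l'; split.
    + by rewrite set0U set0I l0; lra.
    + by rewrite setTU setTI lT; lra.
    + by move=> B D BD; rewrite lerB// lerD// l_homo//; [exact: setSU|exact: setSI].
    + by move=> B; have := lm B; have := l_sub B E; lra.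
    (* By distributivity, submodularity of [l] on the sets joined with [E] and on the sets met with
       [E] adds up to that of [l']. *)
    + move=> B D.
      have := l_sub (B `|` E) (D `|` E); rewrite -setUUl -setUIl.
      have := l_sub (B `&` E) (D `&` E); rewrite -setIUl -setIIl.
      lra.
  have /l_min/asboolP/(_ A)/= : le (exist P l (And5 l0 lT l_homo lm l_sub)) (exist P l' Pl').
    by apply/asboolP => B /=; rewrite /l'; have := l_sub B E; lra.
  by rewrite /l'; lra.
Qed.

(** The modular minorant is taken below the outer extension [m] of [mu], which agrees with [mu] on
    measurable sets. For measurable [A], [l] is at most [mu] on [A] and on its complement, while
    both pairs of values sum to the total mass; so neither inequality is strict. *)
Lemma finitely_additive_extension d (T : measurableType d) (R : realType)
    (mu : {finite_measure set T -> \bar R}) :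
  exists l : set T -> R,
    [/\ forall A, 0 <= l A,
        forall A B, A `&` B = set0 -> l (A `|` B) = l A + l B &
        forall A, measurable A -> (l A)%:E = mu A].
Proof.
pose f A := fine (mu A).
have fE A : measurable A -> (f A)%:E = mu A by move=> mA; rewrite fineK// fin_num_measure.
have f0 A : 0 <= f A by exact: fine_ge0.
have f_homo A B : measurable A -> measurable B -> A `<=` B -> f A <= f B.
  by move=> mA mB AB; rewrite -lee_fin !fE// le_measure// inE.
have f_mod A B : measurable A -> measurable B -> f (A `|` B) + f (A `&` B) = f A + f B.
  move=> mA mB; apply: EFin_inj; rewrite !EFinD !fE//; [|exact: measurableI|exact: measurableU].
  rewrite measureUfinr// ?subeK// ?fin_num_measure//; first exact: measurableI.
  by rewrite ltey_eq fin_num_measure.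
pose C A := [set f B | B in [set B | measurable B /\ A `<=` B]].
have C_inf A : has_inf (C A).
  split; first by exists (f setT), setT; split.
  by exists 0 => _ [B _ <-].
pose m A := inf (C A).
have m_le A B : measurable B -> A `<=` B -> m A <= f B.
  by move=> mB AB; apply: ge_inf; [have [] := C_inf A|exists B].
have mE A : measurable A -> m A = f A.
  move=> mA; apply/eqP; rewrite eq_le m_le//=; apply: lb_le_inf.
    by have [] := C_inf A.
  by move=> _ [B [mB AB] <-]; exact: f_homo.
have m0 : m set0 = 0 by rewrite mE// /f measure0.
have m_homo : {homo m : A B / A `<=` B >-> A <= B}.
  move=> A B AB; apply: lb_le_inf; first by have [] := C_inf B.
  by move=> _ [D [mD BD] <-]; apply: m_le => //; exact: subset_trans BD.
have m_sub A B : m (A `|` B) + m (A `&` B) <= m A + m B.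
  (* Nearly optimal measurable covers [A'] and [B'] have a union and an intersection that cover
     those of [A] and [B], and [f] is modular on them. *)
  apply/ler_addgt0Pr => e e0.
  have e2 : 0 < e / 2 by lra.
  have [_ [A' [mA' AA'] <-] A'e] := inf_adherent e2 (C_inf A).
  have [_ [B' [mB' BB'] <-] B'e] := inf_adherent e2 (C_inf B).
  have := m_le _ _ (measurableU _ _ mA' mB') (setUSS AA' BB').
  have := m_le _ _ (measurableI _ _ mA' mB') (setISS AA' BB').
  have := f_mod _ _ mA' mB'.
  rewrite -/(m A) -/(m B) in A'e B'e.
  lra.
have [l [l0 lT l_homo lm l_mod]] := exists_modular_minorant _ _ m m0 m_homo m_sub.
have l_add A B : A `&` B = set0 -> l (A `|` B) = l A + l B.
  by move=> AB0; rewrite -l_mod AB0 l0 addr0.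
exists l; split => // [A|A mA]; first by rewrite -l0 l_homo.
rewrite -fE//; congr EFin.
have := l_add A (~` A) (setICr A); rewrite setUCr lT mE//.
have := f_mod A (~` A) mA (measurableC mA); rewrite setUCr setICr -(mE set0)// m0.
have := lm A; have := lm (~` A); rewrite !mE//; last exact: measurableC.
lra.
Qed.

(** * Compact sets in Hausdorff spaces *)

(** Otherwise the traces on [K] of the closures of neighbourhoods of [x] would generate a proper
    filter, and a cluster point of it in [K] could not be separated from [x]. *)
Lemma hausdorff_compact_separation (T : topologicalType) (K : set T) (x : T) :
  hausdorff_space T -> compact K -> ~ K x ->
  exists2 W, nbhs x W & closure W `&` K = set0.
Proof.
move=> hT cK Kx; apply: contrapT => noW.
pose F := filter_from (nbhs x) (fun W => closure W `&` K).
have FF : ProperFilter F.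
  apply: filter_from_proper.
    apply: filter_from_filter => [|V W xV xW]; first by exists setT; exact: filterT.
    exists (V `&` W); first exact: filterI.
    by move=> y [VWy Ky]; split; split => //; apply: closure_subset VWy => ? [].
  move=> W xW; apply: contrapT => WK0; apply: noW; exists W => //.
  by apply/seteqP; split => // y WKy; apply: WK0; exists y.
have [|y [Ky Fy]] := cK F FF; first by exists setT; [exact: filterT|move=> ? []].
suff xy : x = y by apply: Kx; rewrite xy.
apply: hT => W V xW yV.
(* Passing to the interior makes [V] a neighbourhood of the point [z] of [closure W], so that [V]
   meets [W] itself. *)
have [z [[Wz _] Vz]] :=
  Fy (closure W `&` K) V^° (ex_intro2 _ _ W xW (fun=> id)) (nbhs_interior yV).
have [t [Wt Vt]] := Wz _ Vz.
by exists t.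
Qed.

(** Being covered in this way is stable under subsets and finite unions and holds near each point of
    [L], so compactness extends it to [L]. *)
Lemma compact_cover_split (T : topologicalType) (L : set T) (G : (set T)^nat) :
  hausdorff_space T -> compact L -> (forall n, open (G n)) ->
  L `<=` \bigcup_n G n ->
  exists (M : (set T)^nat) N, (forall n, compact (M n) /\ M n `<=` G n) /\
    L `<=` \bigcup_(n < N) M n.
Proof.
move=> hT cL oG LG.
pose Q (S : set T) := exists (M : (set T)^nat) N,
  (forall n, compact (M n) /\ M n `<=` G n) /\ S `<=` \bigcup_(n < N) M n.
have QS S S' : S `<=` S' -> Q S' -> Q S.
  by move=> SS' [M [N [MG S'M]]]; exists M, N; split => //; exact: subset_trans S'M.
have QU S S' : Q S -> Q S' -> Q (S `|` S').
  move=> [M [N [MG SM]]] [M' [N' [MG' SM']]].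
  exists (fun n => M n `|` M' n), (maxn N N'); split.
    by move=> n; have [? ?] := MG n; have [? ?] := MG' n; split; [exact: compactU|rewrite subUset].
  move=> t [/SM|/SM'] [n /= nN Mt].
    by exists n; [rewrite /= leq_max nN|left].
  by exists n; [rewrite /= leq_max nN orbT|right].
have Qx x : L x -> exists2 W, nbhs x W & Q (W `&` L).
  move=> Lx; have [k _ Gkx] := LG x Lx.
  have cLG : compact (L `&` ~` G k) by apply: compact_closedI => //; exact: open_closedC.
  have [|W xW WL] := hausdorff_compact_separation _ _ x hT cLG; first by case.
  (* The only nonempty piece has index [k], hence the bound [k.+1]; it lies in [G k] because
     [closure W] misses the part of [L] outside [G k]. *)
  exists W => //; exists (fun n => if n == k then closure W `&` L else set0), k.+1; split.
    move=> n; case: eqP => [->|_]; last by split => //; exact: compact0.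
    split; first by rewrite setIC; apply: compact_closedI => //; exact: closed_closure.
    move=> y [Wy Ly]; apply: contrapT => Gky.
    by have : set0 y by rewrite -WL.
  move=> y [Wy Ly]; exists k => //=; rewrite eqxx.
  by split => //; exact: subset_closure.
(* Otherwise the sets A with Q (L `\` A) form a proper filter clustering in L. *)
apply: contrapT => nQL.
pose F : set_system T := [set A | Q (L `\` A)].
have FF : ProperFilter F.
  split; first by rewrite /F/= setD0.
  split.
  - exists (fun=> set0), 0%N; split; first by move=> n; split => //; exact: compact0.
    by rewrite setDT.
  - by move=> A B FA FB; rewrite /F/= setDIr; exact: QU.
  - by move=> A B AB FA; apply: QS FA; exact: setDS.
have [|x [Lx Fx]] := cL F FF.
  exists (fun=> set0), 0%N; split; first by move=> n; split => //; exact: compact0.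
  by rewrite setDv.
have [W xW QW] := Qx x Lx.
have FW : F (~` W) by rewrite /F/= setDE setCK setIC.
by have [y []] := Fx _ _ FW xW.
Qed.

(** * Borel sets and regularity of tight probabilities *)

Lemma borel_open (T : ptopologicalType) (G : set T) :
  open G -> measurable (G : set (borel T)).
Proof. exact: sub_sigma_algebra. Qed.

Lemma borel_compact (T : ptopologicalType) (K : set T) :
  hausdorff_space T -> compact K -> measurable (K : set (borel T)).
Proof.
move=> hT cK; rewrite -[K]setCK; apply: measurableC; apply: borel_open.
by apply: closed_openC; exact: compact_closed.
Qed.

Lemma inner_regular_approx (R : realType) (T : ptopologicalType)
    (mu : probability (borel T) R) (F : set (set T)) (A : set (borel T)) (e : R) :
  inner_regular mu F -> measurable A -> 0 < e ->
  exists K, [/\ F K, K `<=` A & (mu A - e%:E < mu K)%E].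
Proof.
move=> muF mA e0; have muA := muF A mA.
(* As [mu A] is finite, the supremum is not the value [-oo] of an empty family and is approached
   within [e]. *)
have [|_ [K [FK KA] <-] Ke] := ub_ereal_sup_adherent e0
    (S := [set mu K | K in [set K | F K /\ K `<=` A]]).
  by rewrite -muA fin_num_measure.
by exists K; split => //; rewrite muA.
Qed.

Lemma tight_outer_approx (R : realType) (T : ptopologicalType)
    (mu : probability (borel T) R) (A : set (borel T)) (e : R) :
  hausdorff_space T -> tight mu -> measurable A -> 0 < e ->
  exists G : set T, [/\ open G, A `<=` G & (mu G <= mu A + e%:E)%E].
Proof.
move=> hT [_ mu_reg] mA e0.
have [K [cK KA Ke]] := inner_regular_approx _ _ _ _ _ _ mu_reg (measurableC mA) e0.
have mK := borel_compact _ _ hT cK.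
exists (~` K); split.
- by apply: closed_openC; exact: compact_closed.
- by move=> t At /KA.
- move: Ke; rewrite !probability_setC//.
  rewrite -(fineK (fin_num_measure mu _ mA)) -(fineK (fin_num_measure mu _ mK)).
  by rewrite -!EFinB -EFinD lte_fin lee_fin; lra.
Qed.

(** From a compact [L] of nearly full mass, remove an open [G] that covers the part of [L] outside
    [A] with little excess. What is left is compact and contained in [A]; the loss is at most
    [e / 2] for the complement of [L] and [e / 2] for the excess of [G]. *)
Lemma tight_of_outer_approx (R : realType) (T : ptopologicalType)
    (mu : probability (borel T) R) :
  hausdorff_space T ->
  (forall e : R, 0 < e -> exists2 K, compact K & ((1 - e)%:E <= mu K)%E) ->
  (forall (A : set (borel T)) (e : R), measurable A -> 0 < e ->
    exists G : set T, [/\ open G, A `<=` G & (mu G <= mu A + e%:E)%E]) ->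
  tight mu.
Proof.
move=> hT mu_compact mu_outer; split=> [A _|A mA]; first exact: measure_ge0.
apply/eqP; rewrite eq_le; apply/andP; split; last first.
  apply: ge_ereal_sup => _ [K [cK KA] <-].
  by apply: le_measure => //; rewrite inE//; exact: borel_compact.
apply/lee_addgt0Pr => e e0; have e2 : 0 < e / 2 by lra.
have [L cL Le] := mu_compact _ e2.
have mL := borel_compact _ _ hT cL.
have mLA : measurable (L `\` A : set (borel T)) by exact: measurableD.
have [G [oG LAG Ge]] := mu_outer _ _ mLA e2.
have mG := borel_open _ _ oG.
have cK : compact (L `&` ~` G) by apply: compact_closedI => //; exact: open_closedC.
have mK := borel_compact _ _ hT cK.
apply: (@le_trans _ _ (mu (L `&` ~` G) + e%:E)%E); last first.
  rewrite leeD2r//; apply: ereal_sup_ubound; exists (L `&` ~` G) => //; split => //.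
  by move=> t [Lt nGt]; apply: contrapT => nAt; apply/nGt/LAG.
have cover : A `<=` (L `&` ~` G) `|` (~` L `|` (G `\` (L `\` A))).
  move=> t At; have [Lt|nLt] := pselect (L t); last by right; left.
  have [Gt|nGt] := pselect (G t); last by left.
  by right; right; split => // -[].
have mGLA : measurable (G `\` (L `\` A) : set (borel T)) by exact: measurableD.
have mLC : measurable (~` L : set (borel T)) by exact: measurableC.
have mU := measurableU _ _ mLC mGLA.
apply: (@le_trans _ _ (mu (L `&` ~` G) + (mu (~` L) + mu (G `\` (L `\` A))))%E).
  apply: (@le_trans _ _ (mu ((L `&` ~` G) `|` (~` L `|` (G `\` (L `\` A)))))).
    by apply: le_measure; rewrite ?inE//; exact: measurableU.
  apply: le_trans (measureU2 _ mK mU) _.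
  by rewrite leeD2l//; exact: measureU2.
have muD : mu (G `\` (L `\` A)) = (mu G - mu (L `\` A))%E.
  by rewrite measureD ?(setIidr LAG)// ltey_eq fin_num_measure.
rewrite leeD2l// probability_setC// muD; move: Le Ge.
rewrite -(fineK (fin_num_measure mu _ mL)) -(fineK (fin_num_measure mu _ mG)).
rewrite -(fineK (fin_num_measure mu _ mLA)).
rewrite -[1%E]/(1%:E) -!EFinB -!EFinD !lee_fin; lra.
Qed.

(** * From a finitely additive set function to a tight Borel probability *)

Section content_extension.
Variables (R : realType) (T : ptopologicalType) (l : set T -> R).
Hypotheses (hT : hausdorff_space T) (l_ge0 : forall A, 0 <= l A).
Hypothesis l_add : forall A B, A `&` B = set0 -> l (A `|` B) = l A + l B.
Local Open Scope ereal_scope.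

Definition inner_content (G : set T) : \bar R :=
  ereal_sup [set (l K)%:E | K in [set K | compact K /\ K `<=` G]].

Definition outer_content (A : set T) : \bar R :=
  ereal_inf [set inner_content G | G in [set G | open G /\ A `<=` G]].

Let l0 : l set0 = 0%R.
Proof. by have := l_add set0 set0 (setI0 _); rewrite setU0; lra. Qed.

Let l_homo A B : A `<=` B -> (l A <= l B)%R.
Proof.
by move=> AB; rewrite -(setDUK AB) l_add ?setDIK// lerDl.
Qed.

Let l_subU A B : (l (A `|` B) <= l A + l B)%R.
Proof.
rewrite -(setDUK (@subsetUl _ A B)) l_add ?setDIK// lerD2l l_homo//.
by move=> t [[|]].
Qed.

Let l_sub_bigcup N (M : (set T)^nat) : (l (\bigcup_(n < N) M n) <= \sum_(0 <= n < N) l (M n))%R.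
Proof.
rewrite bigcup_mkord; elim: N => [|N IH]; first by rewrite big_ord0 big_geq// l0.
by rewrite big_ord_recr big_nat_recr//=; apply: le_trans (l_subU _ _) _; rewrite lerD2r.
Qed.

Lemma inner_content_compact K G : compact K -> K `<=` G -> (l K)%:E <= inner_content G.
Proof. by move=> cK KG; apply: ereal_sup_ubound; exists K. Qed.

Lemma inner_content_le G : inner_content G <= (l G)%:E.
Proof. by apply: ge_ereal_sup => _ [K [_ KG] <-]; rewrite lee_fin l_homo. Qed.

Lemma inner_content_ge0 G : 0 <= inner_content G.
Proof. by rewrite -[0]/(0%R%:E) -l0; apply: inner_content_compact => //; exact: compact0. Qed.

Lemma le_inner_content : {homo inner_content : A B / A `<=` B >-> A <= B}.
Proof.
move=> A B AB; apply: ge_ereal_sup => _ [K [cK KA] <-].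
by apply: inner_content_compact => //; exact: subset_trans AB.
Qed.

(** A compact subset of the union is covered by finitely many compact pieces, each inside one [G n],
    so finite subadditivity of [l] suffices. *)
Lemma inner_content_sigma_subadditive (G : (set T)^nat) : (forall n, open (G n)) ->
  inner_content (\bigcup_n G n) <= \sum_(n <oo) inner_content (G n).
Proof.
move=> oG; apply: ge_ereal_sup => _ [K [cK KG] <-].
have [M [N [MG KM]]] := compact_cover_split _ _ _ hT cK oG KG.
apply: (@le_trans _ _ (\sum_(0 <= n < N) (l (M n))%:E)).
  by rewrite sumEFin lee_fin; apply: le_trans (l_homo _ _ KM) (l_sub_bigcup _ _).
apply: (@le_trans _ _ (\sum_(0 <= n < N) inner_content (G n))).
  by apply: lee_sum => n _; have [? ?] := MG n; exact: inner_content_compact.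
by apply: nneseries_lim_ge => n _ _; exact: inner_content_ge0.
Qed.

Lemma outer_content_open G : open G -> outer_content G = inner_content G.
Proof.
move=> oG; apply/eqP; rewrite eq_le; apply/andP; split.
  by apply: ereal_inf_lbound; exists G => //; split => // ?.
by apply: le_ereal_inf_tmp => _ [V [_ GV] <-]; exact: le_inner_content.
Qed.

Lemma outer_content_ge0 A : 0 <= outer_content A.
Proof. by apply: le_ereal_inf_tmp => _ [G _ <-]; exact: inner_content_ge0. Qed.

Lemma le_outer_content : {homo outer_content : A B / A `<=` B >-> A <= B}.
Proof.
move=> A B AB; apply: le_ereal_inf_tmp => _ [G [oG BG] <-].
by apply: ereal_inf_lbound; exists G => //; split => //; exact: subset_trans BG.
Qed.

Lemma outer_content_fin A : outer_content A \is a fin_num.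
Proof.
rewrite ge0_fin_numE ?outer_content_ge0//; apply: (@le_lt_trans _ _ (l setT)%:E); last exact: ltry.
apply: le_trans (inner_content_le setT); rewrite -outer_content_open; last exact: openT.
exact: le_outer_content.
Qed.

Lemma outer_content_approx A e : (0 < e)%R ->
  exists G, [/\ open G, A `<=` G & inner_content G <= outer_content A + e%:E].
Proof.
move=> e0; have [_ [G [oG AG] <-] Ge] := lb_ereal_inf_adherent e0 (outer_content_fin A).
by exists G; split => //; exact: ltW.
Qed.

Lemma outer_content_compact K : compact K -> (l K)%:E <= outer_content K.
Proof.
by move=> cK; apply: le_ereal_inf_tmp => _ [G [_ KG] <-]; exact: inner_content_compact.
Qed.

Lemma outer_content0 : outer_content set0 = 0.
Proof.
apply/eqP; rewrite eq_le outer_content_ge0 andbT outer_content_open; last exact: open0.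
by apply: le_trans (inner_content_le _) _; rewrite l0.
Qed.

Lemma outer_content_sigma_subadditive : sigma_subadditive outer_content.
Proof.
move=> A; apply/lee_addgt0Pr => e e0.
have /choice[G GA] n : exists G, [/\ open G, A n `<=` G &
    inner_content G <= outer_content (A n) + (e / (2 ^ n.+1)%:R)%:E].
  by apply: outer_content_approx; rewrite divr_gt0// ltr0n expn_gt0.
apply: le_trans (epsilon_trick _ _ (ltW e0)); last by move=> n; exact: outer_content_ge0.
apply: (@le_trans _ _ (\sum_(n <oo) inner_content (G n))).
  apply: (@le_trans _ _ (outer_content (\bigcup_n G n))).
    by apply/le_outer_content/subset_bigcup => n _; have [] := GA n.
  rewrite outer_content_open.
    by apply: inner_content_sigma_subadditive => n; have [] := GA n.
  by apply: bigcup_open => n _; have [] := GA n.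
apply: lee_nneseries => [n _ _|n _]; first exact: inner_content_ge0.
by have [] := GA n.
Qed.

HB.instance Definition _ := isOuterMeasure.Build R T outer_content
  outer_content0 outer_content_ge0 le_outer_content outer_content_sigma_subadditive.

(** Nearly fill the part of [V] inside [G] by a compact [K], then the open set of points of [V]
    outside [K], which contains the part of [V] outside [G], by a compact [L]. As [K] and [L] are
    disjoint, [l] adds up on their union, a compact subset of [V]. *)
Lemma inner_content_split V G : open V -> open G ->
  inner_content (V `&` G) + outer_content (V `&` ~` G) <= inner_content V.
Proof.
move=> oV oG; rewrite -leeBrDr ?outer_content_fin//.
apply: ge_ereal_sup => _ [K [cK KVG] <-].
rewrite leeBrDr ?outer_content_fin// addeC -leeBrDr//.
have oVK : open (V `&` ~` K) by apply: openI => //; apply: closed_openC; exact: compact_closed.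
apply: (@le_trans _ _ (outer_content (V `&` ~` K))).
  by apply: le_outer_content => t [Vt nGt]; split => // /KVG[].
rewrite outer_content_open//; apply: ge_ereal_sup => _ [L [cL LVK] <-].
rewrite leeBrDr// -EFinD -l_add.
  apply: inner_content_compact; first exact: compactU.
  by rewrite subUset; split; [move=> t /LVK[]|move=> t /KVG[]].
by apply/seteqP; split => // t [/LVK[_ nKt]].
Qed.

(** The outer content is an infimum over open supersets, so the splitting inequality need only be
    tested on open sets. *)
Lemma open_caratheodory G : open G -> outer_content.-caratheodory G.
Proof.
move=> oG; apply: le_caratheodory_measurable => X.
apply: le_ereal_inf_tmp => _ [V [oV XV] <-].
apply: le_trans (inner_content_split _ _ oV oG).
rewrite -[inner_content _]outer_content_open; last exact: openI.
by apply: leeD; apply: le_outer_content; exact: setSI.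
Qed.

Lemma borel_caratheodory (A : set (borel T)) :
  measurable A -> outer_content.-caratheodory A.
Proof.
apply: smallest_sub; last exact: open_caratheodory.
split.
- exact: caratheodory_measurable_set0.
- by move=> B /caratheodory_measurable_setC; rewrite setTD.
- exact: caratheodory_measurable_bigcup.
Qed.

(* A copy of outer_content carrying the measure structure on Borel sets. *)
Definition borel_content : set (borel T) -> \bar R := outer_content.

Lemma borel_content_sigma_additive : semi_sigma_additive borel_content.
Proof.
move=> A mA tA mbigcupA.
apply: (@caratheodory_measure_sigma_additive R T outer_content) => //.
- by move=> n; exact/borel_caratheodory.
- exact/borel_caratheodory.
Qed.

HB.instance Definition _ := isMeasure.Build _ (borel T) R borel_content
  outer_content0 outer_content_ge0 borel_content_sigma_additive.

Hypothesis l1 : l setT = 1%R.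
Hypothesis l_tight : forall e : R, (0 < e)%R -> exists2 K, compact K & (1 - e <= l K)%R.

Lemma borel_content_setT : borel_content setT = 1.
Proof.
rewrite /borel_content outer_content_open; last exact: openT.
apply/eqP; rewrite eq_le -{1}l1 inner_content_le /=.
apply/lee_addgt0Pr => e e0; have [K cK Ke] := l_tight _ e0.
apply: (@le_trans _ _ ((l K)%:E + e%:E)).
  by rewrite -EFinD lee_fin; lra.
by rewrite leeD2r//; exact: inner_content_compact.
Qed.

HB.instance Definition _ := Measure_isProbability.Build _ (borel T) R borel_content
  borel_content_setT.

(** Since [l] is only finitely additive, [rho] need not agree with it; the two one-sided bounds are
    what the construction keeps. Tightness comes from [l_tight] and from the outer approximation by
    open sets built into [outer_content]. *)
Lemma content_tight_probability : exists rho : probability (borel T) R,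
  [/\ tight rho, forall K, compact K -> (l K)%:E <= rho K &
      forall G, open G -> rho G <= (l G)%:E].
Proof.
exists borel_content; split.
- apply: tight_of_outer_approx => // [e e0|A e mA e0].
    have [K cK Ke] := l_tight _ e0; exists K => //.
    by apply: le_trans (outer_content_compact _ cK); rewrite lee_fin.
  have [G [oG AG Ge]] := outer_content_approx A e e0.
  by exists G; split => //; rewrite /= /borel_content outer_content_open.
- exact: outer_content_compact.
- by move=> G oG; rewrite /= /borel_content outer_content_open//; exact: inner_content_le.
Qed.

End content_extension.

(** * Lifting a tight probability along a continuous surjection *)

Lemma borel_preimage (X Y : ptopologicalType) (f : Y -> X) (A : set (borel X)) :
  continuous f -> measurable A -> measurable (f @^-1` A : set (borel Y)).
Proof.
move=> cf.
suff : @measurable _ (borel X) `<=`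
    [set A | @measurable _ (borel Y) (f @^-1` A)] by exact.
apply: smallest_sub; last by move=> G oG; apply: borel_open; exact: open_comp.
split => [|B mB|B mB] /=.
- by rewrite preimage_set0.
- by rewrite setTD preimage_setC; exact: measurableC.
- by rewrite preimage_bigcup; apply: bigcup_measurable => n _; exact: mB.
Qed.

(** Trajectories enter the argument only through continuity of the evaluation map and separation of
    their space, so it is carried out for any continuous [f]. *)
Lemma lift_tight_probability (R : realType) (X Y : ptopologicalType)
    (f : Y -> X) (U : set Y) (K' : set (set X)) (mu : probability (borel X) R) :
  hausdorff_space X -> hausdorff_space Y -> continuous f -> f @` U = setT ->
  (forall K, K' K -> compact K) ->
  (forall K, K' K -> compact (f @^-1` K `&` U)) ->
  tight mu -> inner_regular mu K' ->
  exists rho : probability (borel Y) R, [/\ tight rho,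
    exists V : set (borel Y), [/\ measurable V, V `<=` U & rho (~` V) = 0%E] &
    forall A : set (borel X), measurable A -> rho (f @^-1` A) = mu A].
Proof.
move=> hX hY cf fU cK' cfK' mu_tight mu_reg.
have /choice[s sU] x : exists u, U u /\ f u = x.
  by have : [set: X] x by []; rewrite -fU => -[u Uu <-]; exists u.
have fs (A : set X) : s @^-1` (f @^-1` A) = A.
  by apply/seteqP; split => x /=; rewrite (sU x).2.
(* As [s] is valued in [U], intersecting with [U] costs no mass after pushing forward: the compact
   sets over [K] receive exactly the mass [mu K]. *)
have fsU (A : set X) : s @^-1` (f @^-1` A `&` U) = A.
  rewrite preimage_setI fs; apply/setIidPl => x _; exact: (sU x).1.
have [l [l_ge0 l_add lE]] := finitely_additive_extension _ (borel X) R mu.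
have mK K : K' K -> measurable (K : set (borel X)).
  by move=> /cK'; exact: borel_compact.
have mu_approx e : 0 < e -> exists2 K, K' K & ((1 - e)%:E <= mu K)%E.
  move=> e0; have [K [K'K _ Ke]] := inner_regular_approx _ _ _ _ _ _ mu_reg measurableT e0.
  by exists K => //; move: Ke; rewrite probability_setT => /ltW.
pose lY (A : set Y) := l (s @^-1` A).
have [|A B AB0|||rho [rho_tight rho_compact rho_open]] :=
    content_tight_probability R Y lY hY.
- by move=> A; exact: l_ge0.
- by rewrite /lY preimage_setU l_add// -preimage_setI AB0 preimage_set0.
- by apply: EFin_inj; rewrite /lY preimage_setT lE//; exact: probability_setT.
- move=> e /mu_approx[K K'K Ke]; exists (f @^-1` K `&` U); first exact: cfK'.
  by rewrite -lee_fin /lY fsU lE//; exact: mK.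
exists rho; split => //.
(* [U] need not be Borel; a countable union of compact sets inside it, of masses at least
   [1 - 1 / (n + 1)], is a Borel carrier. *)
- have /choice[K KE] (n : nat) : exists K, K' K /\ ((1 - n.+1%:R^-1)%:E <= mu K)%E.
    by have [|K K'K Kn] := mu_approx n.+1%:R^-1; [rewrite invr_gt0|exists K].
  pose C n : set (borel Y) := f @^-1` K n `&` U.
  have cC n : compact (C n : set Y) by apply: cfK'; exact: (KE n).1.
  have mC n : measurable (C n) by exact: borel_compact.
  have mV : measurable (\bigcup_n C n) by exact: bigcup_measurable.
  exists (\bigcup_n C n); split => //; first by move=> u [n _ []].
  apply/eqP; rewrite eq_le measure_ge0 andbT; apply/lee_addgt0Pr => e e0.
  have [n ne] := ltr_add_invr e0; rewrite add0r in ne.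
  apply: (@le_trans _ _ (rho (~` C n))).
    apply: le_measure; rewrite ?inE; [exact: measurableC|exact: measurableC|].
    by move=> u nVu Cu; apply: nVu; exists n.
  have : ((1 - n.+1%:R^-1)%:E <= rho (C n))%E.
    apply: le_trans (rho_compact _ (cC n)); apply: le_trans (KE n).2 _.
    by rewrite /lY fsU lE//; apply: mK; exact: (KE n).1.
  rewrite probability_setC// -(fineK (fin_num_measure rho _ (mC n))).
  rewrite add0e -[1%E]/(1%:E) -EFinB !lee_fin.
  by move: (_^-1) ne => r; lra.
- have rho_le (A : set (borel X)) : measurable A -> (rho (f @^-1` A) <= mu A)%E.
    move=> mA; apply/lee_addgt0Pr => e e0.
    have [G [oG AG Ge]] := tight_outer_approx _ _ _ _ _ hX mu_tight mA e0.
    apply: le_trans Ge.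
    have ofG : open (f @^-1` G) by exact: open_comp.
    apply: (@le_trans _ _ (rho (f @^-1` G))).
      apply: le_measure; rewrite ?inE; [exact: borel_preimage|exact: borel_open|].
      exact: preimage_subset.
    apply: le_trans (rho_open _ ofG) _.
    by rewrite /lY fs lE//; exact: borel_open.
  move=> A mA; apply/eqP; rewrite eq_le rho_le//=.
  have mfA := borel_preimage _ _ f _ cf mA.
  have := rho_le _ (measurableC mA); rewrite -preimage_setC !probability_setC//.
  rewrite -(fineK (fin_num_measure rho _ mfA)) -(fineK (fin_num_measure mu _ mA)).
  by rewrite -[1%E]/(1%:E) -!EFinB !lee_fin; lra.
Qed.

(** * Evaluation maps on the trajectory space, and the theorem *)

(** The preimage of an open set is a single subbase element, that of the degenerate segment reduced
    to [t]. *)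
Lemma Pi_continuous (R : realType) (I : interval R) (X : topologicalType)
    (t : set_type [set` I]) : continuous (@Pi R I X t).
Proof.
have tI : [set` I] (\val t) by exact/set_mem/valP.
apply/continuousP => O oO.
have -> : Pi t @^-1` O = Cloc_subbase (\val t, \val t, O) :> set (Cloc I X).
  apply/seteqP; split => u /=; last by move=> uO; apply: uO; exists t; rewrite //= in_itv/= lexx.
  move=> Out _ [r /= + <-]; rewrite in_itv/= => /le_anti rt.
  by rewrite (_ : r = t)//; apply: val_inj.
(* Open sets are unions of finite intersections of subbase sets; here the union and the intersection
   have one member each. *)
exists [set Cloc_subbase (\val t, \val t, O)]; last by rewrite bigcup_set1.
move=> _ ->; exists (finmap.fset1 (\val t, \val t, O)).
  move=> p /[!inE] /eqP ->; split => //= r.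
  by rewrite /= in_itv/= => /le_anti <-.
by rewrite set_fset1 bigcap_set1.
Qed.

(** Evaluations being continuous, two functions that cannot be separated take inseparable, hence
    equal, values at every [t]. *)
Lemma Cloc_hausdorff (R : realType) (I : interval R) (X : topologicalType) :
  hausdorff_space X -> hausdorff_space (Cloc I X).
Proof.
move=> hX u v uv; apply/continuousEP => t; apply: hX => A B uA vB.
have [w [Aw Bw]] := uv _ _ (Pi_continuous _ _ _ t u _ uA) (Pi_continuous _ _ _ t v _ vB).
by exists (w t).
Qed.

Theorem theorem3p1 (R : realType) (X : ptopologicalType)
    (hX : hausdorff_space X)
    (I : interval R) (t0 : set_type [set` I])
    (hI : exists b : itv_bound R, I = Interval (BLeft (\val t0)) b)
    (U : set (Cloc I X))
    (H1 : Pi t0 @` U = [set: X])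
    (K' : set (set X))
    (hK' : forall K, K' K -> compact K)
    (H2 : forall mu : probability (borel X) R, tight mu -> inner_regular mu K')
    (H3 : forall K, K' K -> compact ((Pi t0 @^-1` K) `&` U))
    (mu0 : probability (borel X) R) (hmu0 : tight mu0) :
  exists rho : probability (borel (Cloc I X)) R,
    trajectory_statistical_solution U rho /\
    (forall A : set (borel X), measurable A ->
       pushforward rho (Pi t0 : borel (Cloc I X) -> borel X) A = mu0 A).
Proof.
have [rho [rho_tight rhoU rhoE]] := lift_tight_probability _ _ _ _ _ _ _ hX
  (Cloc_hausdorff _ _ _ hX) (Pi_continuous _ _ _ t0) H1 hK' H3 hmu0 (H2 _ hmu0).
by exists rho.
Qed.
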